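(* Suppose that the MDP is unichain, the environment is oblivious (it chooses a fixed sequence $\boldsymbol f=(f_1,\dots,f_T)\in\mathcal F^T$ not depending on states and actions), and that for each $P\in\mathcal M(\mathsf U|\mathsf X)$ and $f\in\mathcal F$ there is a solution $\widehat Q_{P,f}$ of the reverse Poisson inequality for $P$ with forcing function $f$, with $L(\mathsf X,\mathsf U,\mathcal F)=\sup_{P}\sup_{f\in\mathcal F}\|\widehat Q_{P,f}\|_\infty<\infty$. Let $\{\widehat W_{y,t}\}_{t=0}^T$, $y\in\mathsf X$, be any family of admissible relaxations (one for each state $y$) and let $\widehat{\boldsymbol\gamma}$ be the corresponding behavioral strategy. Then for every initial state $x\in\mathsf X$ and every $\boldsymbol f\in\mathcal F^T$, $$\mathbb E_x^{\widehat{\boldsymbol\gamma},\boldsymbol f}\Big[\sum_{t=1}^T f_t(X_t,U_t)-\Psi(\boldsymbol f)\Big]\le \sup_{P\in\mathcal M(\mathsf U|\mathsf X)}\sum_{y\in\mathsf X}\pi_P(y)\,\widehat W_{y,0}+C_{\mathcal F}\sum_{t=1}^T\|\mu_t-\pi_t\|_1 ,$$ where $C_{\mathcal F}=\sup_{f\in\mathcal F}\|f\|_\infty$, $\mu_t$ is the distribution of $X_t$ under $(\widehat{\boldsymbol\gamma},\boldsymbol f)$ with $X_1=x$, and $\pi_t=\pi_{P_t}$ is the invariant distribution of $K(\cdot|\cdot,P_t)$, with $P_t$ the state feedback law used by $\widehat{\boldsymbol\gamma}$ at time $t$.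
   Context: $\mathsf X,\mathsf U$ are finite nonempty sets (states, actions); $K(y|x,u)$ is a fixed transition kernel (probability of next state $y$ given state $x$ and action $u$); $\mathcal P(\cdot)$ denotes the set of probability distributions on a finite set; $\mathcal M(\mathsf U|\mathsf X)$ is the set of Markov matrices $P=[P(u|x)]$, $P(\cdot|x)\in\mathcal P(\mathsf U)$. For $P\in\mathcal M(\mathsf U|\mathsf X)$, $K(y|x,P)=\sum_uK(y|x,u)P(u|x)$. The MDP is unichain if for every $P\in\mathcal M(\mathsf U|\mathsf X)$ the chain with kernel $K(\cdot|\cdot,P)$ has a single recurrent class, equivalently a unique invariant distribution, denoted $\pi_P$. $(\pi\otimes P)(x,u)=\pi(x)P(u|x)$; $\langle\nu,f\rangle$ is the expectation of $f$ under $\nu$; $\|\cdot\|_1$ is the $\ell_1$ norm; $\|f\|_\infty$ is the sup norm. $\mathcal F$ is a fixed nonempty class of functions $\mathsf X\times\mathsf U\to\mathbb R$, uniformly bounded ($C_{\mathcal F}<\infty$), and $T\ge1$ is a fixed horizon. Game: $X_1=x$. For $t=1,\dots,T$: the agent observes $X_t$, draws $U_t\sim\gamma_t(X_t,f^{t-1})\in\mathcal P(\mathsf U)$ where $f^{t-1}=(f_1,\dots,f_{t-1})$; $f_t\in\mathcal F$ is revealed; the cost $f_t(X_t,U_t)$ is incurred; then $X_{t+1}\sim K(\cdot|X_t,U_t)$. $\boldsymbol\gamma=(\gamma_1,\dots,\gamma_T)$ is the agent's (Markov) behavioral strategy; the state feedback law used at time $t$ is $P_t(u|x)=[\gamma_t(x,f^{t-1})](u)$.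 $\mathbb E^{\boldsymbol\gamma,\boldsymbol f}_x$ is the resulting expectation. The comparator is $\Psi(\boldsymbol f)=\inf_{P}\sum_{t=1}^T\langle\pi_P\otimes P,f_t\rangle$, the infimum being over all $P\in\mathcal M(\mathsf U|\mathsf X)$ for which $K(\cdot|\cdot,P)$ has a unique invariant distribution. Reverse Poisson inequality: $\widehat Q:\mathsf X\times\mathsf U\to\mathbb R$ satisfies the reverse Poisson inequality for $P$ with forcing function $g:\mathsf X\times\mathsf U\to\mathbb R$ if for all $(x,u)$ $$\sum_yK(y|x,u)\widehat Q(y,P)-\widehat Q(x,u)\ge -g(x,u)+\langle\pi_P\otimes P,g\rangle,\qquad \widehat Q(y,P)=\sum_{u'}P(u'|y)\widehat Q(y,u').$$ A choice $(P,f)\mapsto\widehat Q_{P,f}$ of such solutions is fixed. For $y\in\mathsf X$ let $\mathcal H_y=\{\widehat Q_{P,f}(y,\cdot): P\in\mathcal M(\mathsf U|\mathsf X), f\in\mathcal F\}$, a class of functions $\mathsf U\to\mathbb R$. A sequence of functions $\widehat W_{y,t}:\mathcal H_y^t\to\mathbb R$, $t=0,\dots,T$ ($\widehat W_{y,0}$ is a constant), is an admissible relaxation at state $y$ if for all $h_1,\dots,h_T\in\mathcal H_y$ $$\widehat W_{y,T}(h_1,\dots,h_T)\ge-\inf_{\nu\in\mathcal P(\mathsf U)}\mathbb E_{U\sim\nu}\Big[\sum_{t=1}^Th_t(U)\Big],$$ $$\widehat W_{y,t}(h_1,\dots,h_t)\ge\inf_{\nu\in\mathcal P(\mathsf U)}\sup_{h\in\mathcal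 H_y}\big\{\mathbb E_{U\sim\nu}[h(U)]+\widehat W_{y,t+1}(h_1,\dots,h_t,h)\big\},\quad t=T-1,\dots,0.$$ The corresponding behavioral strategy $\widehat{\boldsymbol\gamma}$ is defined recursively: at time $t$, for every state $y$, $$\widehat\gamma_t(y,f^{t-1})=P_t(\cdot|y)\in\operatorname*{arg\,min}_{\nu\in\mathcal P(\mathsf U)}\sup_{h\in\mathcal H_y}\big\{\mathbb E_{U\sim\nu}[h(U)]+\widehat W_{y,t}(h_{y,1},\dots,h_{y,t-1},h)\big\},$$ and, after $f_t$ is revealed, $h_{y,t}=\widehat Q_{P_t,f_t}(y,\cdot)$ for every $y\in\mathsf X$. *)

(* Defs.v *)
From HB Require Import structures.
From mathcomp Require Import all_boot all_order all_algebra.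
From mathcomp Require Import boolp classical_sets reals ereal.

Set Implicit Arguments.
Unset Strict Implicit.
Unset Printing Implicit Defensive.

Import Order.TTheory GRing.Theory Num.Theory.
Local Open Scope classical_set_scope.
Local Open Scope ring_scope.

Section FiniteDistributions.
Variables (R : realType) (A : finType).

Definition distr : set (A -> R) :=
  [set p | (forall a, 0 <= p a) /\ \sum_a p a = 1].

Definition l1_norm (p : A -> R) : R := \sum_a `|p a|.

End FiniteDistributions.

Section MDP.
Variables (R : realType) (X U : finType).

(* [P x u] is P(u|x). *)
Definition markov : set (X -> U -> R) := [set P | forall x, distr (P x)].

(* [K x u y] is K(y|x,u). *)
Variable K : X -> U -> X -> R.

(* [closed_loop P x y] is K(y|x,P). *)
Definition closed_loop (P : X -> U -> R) (x y : X) : R :=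
  \sum_u K x u y * P x u.

Definition step (P : X -> U -> R) : rel X :=
  [rel x y | 0 < closed_loop P x y].

(* In a finite chain, a state is recurrent iff it can be reached back from
   every state it leads to; the recurrent classes are the communication classes
   of the recurrent states. *)
Definition recurrent (P : X -> U -> R) (x : X) : Prop :=
  forall y, connect (step P) x y -> connect (step P) y x.

Definition recurrent_class (P : X -> U -> R) (C : {set X}) : Prop :=
  exists2 x, recurrent P x & C = [set y | connect (step P) x y]%SET.

Definition unichain : Prop :=
  forall P, markov P -> exists! C : {set X}, recurrent_class P C.

Definition invariant_distr (P : X -> U -> R) : set (X -> R) :=
  [set p | distr p /\ forall y, p y = \sum_x p x * closed_loop P x y].

Definition has_unique_invariant (P : X -> U -> R) : Prop :=
  exists! p, invariant_distr P p.

(* pi_P; meaningful when the invariant distribution of K(.|.,P) is unique, as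
   it is for every P when the MDP is unichain. *)
Definition inv_distr (P : X -> U -> R) : X -> R :=
  xget (fun=> 0) (invariant_distr P).

(* [pairing p P f] is < p \otimes P , f >. *)
Definition pairing (p : X -> R) (P f : X -> U -> R) : R :=
  \sum_x \sum_u p x * P x u * f x u.

Definition sup_norm (f : X -> U -> R) : R :=
  \big[Num.max/0]_x \big[Num.max/0]_u `|f x u|.

(* C_F; meaningful when the norms are bounded above on a nonempty F. *)
Definition class_bound (F : set (X -> U -> R)) : R :=
  sup [set sup_norm f | f in F].

(* Psi(f) for f = (f_1, ..., f_T). *)
Definition comparator T (f : T.-tuple (X -> U -> R)) : R :=
  inf [set \sum_(t < T) pairing (inv_distr P) P (tnth f t)
      | P in [set P | markov P /\ has_unique_invariant P]].

Definition reverse_poisson (P g Q : X -> U -> R) : Prop :=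
  forall x u,
    (\sum_y K x u y * \sum_u' P y u' * Q y u') - Q x u
      >= - g x u + pairing (inv_distr P) P g.

(* A behavioral strategy maps the revealed history f^{t-1} = (f_1, ..., f_{t-1})
   to the state feedback law P_t; the time t is the length of the history plus
   one, so [gamma fs x u] is [gamma_t(x, f^{t-1})](u). *)
Definition strategy := seq (X -> U -> R) -> X -> U -> R.

(* State feedback law P_{t+1} used at the (t+1)-st step against f. *)
Definition feedback (gamma : strategy) (f : seq (X -> U -> R)) (t : nat) :
  X -> U -> R := gamma (take t f).

(* Probability of the trajectory (X_1,U_1), (X_2,U_2), ... when X_1 ~ init,
   U_t ~ P_t(.|X_t) with P_t = [Ps t.-1], and X_{t+1} ~ K(.|X_t,U_t). *)
Fixpoint traj_prob (init : X -> R) (Ps : nat -> X -> U -> R)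
    (w : seq (X * U)) : R :=
  if w is (x, u) :: w' then
    init x * Ps 0%N x u * traj_prob (K x u) (fun t => Ps t.+1) w'
  else 1.

(* E_x^{gamma,f}[Z], for Z a function of (X_1,U_1), ..., (X_T,U_T). *)
Definition expectation (gamma : strategy) T (f : T.-tuple (X -> U -> R)) (x : X)
    (Z : T.-tuple (X * U) -> R) : R :=
  \sum_(w : T.-tuple (X * U))
    traj_prob (fun y => (y == x)%:R) (feedback gamma f) w * Z w.

(* mu_{t+1}, the distribution of the state at the (t+1)-st step. *)
Definition state_distr (gamma : strategy) T (f : T.-tuple (X -> U -> R)) (x : X)
    (t : 'I_T) (y : X) : R :=
  expectation gamma f x (fun w => ((tnth w t).1 == y)%:R).

End MDP.

Section Relaxations.
Variables (R : realType) (X U : finType).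

(* The class H_y, for [Q P f] the chosen solution for P and f. *)
Definition Qclass (F : set (X -> U -> R))
    (Q : (X -> U -> R) -> (X -> U -> R) -> X -> U -> R) (y : X) :
    set (U -> R) :=
  [set h | exists P f, [/\ markov P, F f & h = Q P f y]].

(* sup_{h in H} { E_{U~nu}[h(U)] + W(h_1, ..., h_t, h) }, in the extended
   reals since W may be unbounded above on H. *)
Definition relax_value (H : set (U -> R)) (W : seq (U -> R) -> R)
    (hs : seq (U -> R)) (nu : U -> R) : \bar R :=
  ereal_sup [set (\sum_u nu u * h u + W (rcons hs h))%:E | h in H].

(* The functions W_0, ..., W_T are given as a single function on sequences: W_t
   is its restriction to sequences of length t with entries in H. *)
Definition admissible (T : nat) (H : set (U -> R)) (W : seq (U -> R) -> R) :
    Prop :=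
  (forall hs : T.-tuple (U -> R), (forall i, H (tnth hs i)) ->
    W hs >= - inf [set \sum_u nu u * \sum_(t < T) tnth hs t u
                  | nu in @distr R U]) /\
  (forall t, (t < T)%N ->
   forall hs : t.-tuple (U -> R), (forall i, H (tnth hs i)) ->
    (ereal_inf [set relax_value H W hs nu | nu in @distr R U]
       <= (W hs)%:E)%E).

(* (h_{y,1}, ..., h_{y,t}), where h_{y,s} = Q_{P_s,f_s}(y,.). *)
Definition Qhistory (Q : (X -> U -> R) -> (X -> U -> R) -> X -> U -> R)
    (gamma : strategy R X U) (fs : seq (X -> U -> R)) (y : X) : seq (U -> R) :=
  mkseq (fun s => Q (feedback gamma fs s) (nth (fun _ _ => 0) fs s) y)
        (size fs).

Definition is_argmin (S : set (U -> R)) (v : (U -> R) -> \bar R)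
    (nu : U -> R) : Prop :=
  S nu /\ forall nu', S nu' -> (v nu <= v nu')%E.

Definition relaxation_strategy (T : nat) (F : set (X -> U -> R))
    (Q : (X -> U -> R) -> (X -> U -> R) -> X -> U -> R)
    (W : X -> seq (U -> R) -> R) (gamma : strategy R X U) : Prop :=
  forall t, (t < T)%N ->
  forall fs : t.-tuple (X -> U -> R), (forall i, F (tnth fs i)) ->
  forall y, is_argmin (@distr R U)
              (relax_value (Qclass F Q y) (W y) (Qhistory Q gamma fs y))
              (gamma fs y).

End Relaxations.

(* Main.v *)
Require Import Defs.
From HB Require Import structures.
From mathcomp Require Import all_boot all_order all_algebra.
From mathcomp Require Import boolp classical_sets reals ereal.

(* Replacing mu_t by pi_t costs C_F ||mu_t - pi_t||_1 per step. Integrating the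
   reverse Poisson inequality for (P_t, f_t) against pi_P \otimes P bounds
   <pi_t \otimes P_t, f_t> - <pi_P \otimes P, f_t> by the pi_P-average over y
   of the instantaneous regret of P_t(.|y) against P(.|y) for the loss h_{y,t}.
   At each y the admissibility inequalities telescope, so the cumulative regret
   is at most W_{y,0}.

   As [inf] of the empty set is 0, the comparator is meaningful only because
   some P has a unique invariant distribution. In a unichain model every P has
   one: a fixed vector v of the stochastic matrix exists by singularity of
   K - 1, |v| is then fixed as well, and two invariant distributions cannot
   differ because the supports of the positive and negative parts of their
   difference would both contain the single recurrent class. *)

Set Implicit Arguments.
Unset Strict Implicit.
Unset Printing Implicit Defensive.

Import Order.TTheory GRing.Theory Num.Theory.
Local Open Scope classical_set_scope.
Local Open Scope ring_scope.

(** Among the states reachable from [x], one with the smallest reach set works: any state reached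
    from it has a reach set contained in, hence equal to, its own. *)
Lemma connect_terminal (X : finType) (e : rel X) x :
  exists2 y, connect e x y & forall z, connect e y z -> connect e z y.
Proof.
case: (arg_minnP (fun y => #|connect e y|) (connect0 e x)) => y xy ymin.
exists y => // z yz; have sub : connect e z \subset connect e y.
  by apply/fintype.subsetP => w; rewrite !inE => /(connect_trans yz).
have /subset_cardP/(_ sub)/(_ y) : #|connect e z| = #|connect e y|.
  apply/eqP; rewrite eqn_leq subset_leq_card //= ymin //.
  exact: connect_trans yz.
by rewrite !inE connect0.
Qed.

(** * Invariant measures of a finite stochastic matrix *)

Section InvariantMeasures.
Variables (R : realType) (X : finType) (k : X -> X -> R).
Hypothesis k_distr : forall x, distr (k x).

Definition invariant_measure (v : X -> R) : Prop :=
  forall y, v y = \sum_x v x * k x y.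

Lemma sum_stochastic (v : X -> R) :
  \sum_y \sum_x v x * k x y = \sum_x v x.
Proof.
rewrite exchange_big; apply: eq_bigr => x _.
by rewrite -mulr_sumr (k_distr x).2 mulr1.
Qed.

(* By the triangle inequality [|v|] is subinvariant, and both sides have the
   same total mass. *)
Lemma invariant_measure_norm v :
  invariant_measure v -> invariant_measure (fun x => `|v x|).
Proof.
move=> vk; have sub y : 0 <= \sum_x `|v x| * k x y - `|v y|.
  rewrite subr_ge0 {1}vk; apply: le_trans (ler_norm_sum _ _ _) _.
  by apply: ler_sum => x _; rewrite normrM (ger0_norm ((k_distr x).1 y)).
have : \sum_y (\sum_x `|v x| * k x y - `|v y|) = 0.
  by rewrite sumrB sum_stochastic subrr.
move=> /psumr_eq0P vk0 y; apply/esym/eqP; rewrite -subr_eq0.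
by apply/eqP/vk0.
Qed.

Lemma invariant_measure_neq0 :
  (0 < #|X|)%N -> exists2 v, invariant_measure v & exists x, v x != 0.
Proof.
move=> /card_gt0P[x0 _].
pose A := \matrix_(i < #|X|, j < #|X|) k (enum_val i) (enum_val j).
have : \det (A - 1%:M) == 0.
  (* Rows of [k] sum to 1, so [A - 1] kills the constant column; transposing turns it into the left
     kernel vector that [det0P] asks for. *)
  rewrite -det_tr; apply/det0P; exists (const_mx 1).
    by apply/rV0Pn; exists (enum_rank x0); rewrite mxE oner_neq0.
  apply/rowP => i; rewrite linearB /= trmx1 mulmxBr mulmx1 !mxE.
  under eq_bigr do rewrite !mxE mul1r.
  by rewrite -(big_enum_val (fun y => k (enum_val i) y)) (k_distr _).2 subrr.
move=> /det0P[w w0 /eqP]; rewrite mulmxBr mulmx1 subr_eq0 => /eqP wA.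
exists (fun x => w 0 (enum_rank x)) => [y|].
  rewrite -{1}wA mxE (big_enum_val (fun x => w 0 (enum_rank x) * k x y)).
  by apply: eq_bigr => i _; rewrite mxE enum_valK enum_rankK.
by have /rV0Pn[i wi] := w0; exists (enum_val i); rewrite enum_valK.
Qed.

(** In the invariance equation at a successor of [x], the term of index [x] is already positive, so
    positivity travels along paths. *)
Lemma invariant_measure_support (e : rel X) (v : X -> R) x y :
  (forall a b, e a b -> 0 < k a b) ->
  (forall z, 0 <= v z) -> invariant_measure v ->
  connect e x y -> 0 < v x -> 0 < v y.
Proof.
move=> ek v0 vk /connectP[p]; elim: p x => [|z p IHp] x /=.
  by move=> _ ->.
move=> /andP[/ek xz zp] yE vx; apply: IHp zp yE _.
rewrite vk (bigD1 x) //= ltr_pwDl ?mulr_gt0 // sumr_ge0 // => a _.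
by rewrite mulr_ge0 // (k_distr a).1.
Qed.

End InvariantMeasures.

(** * Existence and uniqueness of the invariant distribution in a unichain model *)

Section UniqueInvariant.
Variables (R : realType) (X U : finType) (K : X -> U -> X -> R).
Hypothesis K_kernel : forall x u, distr (K x u).

Lemma closed_loop_distr P x : markov P -> distr (closed_loop K P x).
Proof.
move=> mP; split=> [y|].
  by apply: sumr_ge0 => u _; rewrite mulr_ge0 ?(K_kernel _ _).1 ?(mP x).1.
rewrite exchange_big /= -(mP x).2; apply: eq_bigr => u _.
by rewrite -mulr_suml (K_kernel x u).2 mul1r.
Qed.

Lemma unichain_unique_invariant P :
  (0 < #|X|)%N -> unichain K -> markov P -> has_unique_invariant K P.
Proof.
move=> X0 uK mP; have kd x := closed_loop_distr x mP.
have [v vk [x0 vx0]] := invariant_measure_neq0 kd X0.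
have sum_norm_gt0 (w : X -> R) x : w x != 0 -> 0 < \sum_y `|w y|.
  by move=> wx; rewrite (bigD1 x) //= ltr_pwDl ?normr_gt0 // sumr_ge0.
have s0 := sum_norm_gt0 v x0 vx0; set s := \sum_y _ in s0.
have inv_v : invariant_distr K P (fun x => `|v x| / s).
  split; first split=> [x|]; first by rewrite divr_ge0 // ltW.
    by rewrite -mulr_suml divff // gt_eqF.
  move=> y; rewrite {1}(invariant_measure_norm kd vk) mulr_suml.
  by apply: eq_bigr => x _; rewrite mulrAC.
have inv_sub p q : invariant_measure (closed_loop K P) p ->
    invariant_measure (closed_loop K P) q ->
    invariant_measure (closed_loop K P) (fun x => p x - q x).
  move=> pk qk y; rewrite {1}pk {1}qk -sumrB.
  by apply: eq_bigr => x _; rewrite mulrBl.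
have [C [[c rc CE] Cuniq]] := uK P mP.
(* Mass at some [x] spreads to a recurrent state [y], whose class is [C] by uniqueness, and from
   there to [c]. *)
have full (m : X -> R) : (forall x, 0 <= m x) ->
    invariant_measure (closed_loop K P) m -> 0 < \sum_x m x -> 0 < m c.
  move=> m0 mk sm; have /eqP := lt0r_neq0 sm.
  move=> /(psumr_neq0P (fun x _ => m0 x))[x /= mx].
  have [y xy ry] := connect_terminal (step K P) x.
  have stepP a b : step K P a b -> 0 < closed_loop K P a b by [].
  have my := invariant_measure_support kd stepP m0 mk xy mx.
  have CEy : C = [set z | connect (step K P) y z]%SET.
    by apply: Cuniq; exists y.
  have yc : connect (step K P) y c.
    have : c \in C by rewrite CE inE connect0.
    by rewrite CEy inE.
  exact (invariant_measure_support kd stepP m0 mk yc my).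
suff uniq p q : invariant_distr K P p -> invariant_distr K P q -> p = q.
  by exists (fun x => `|v x| / s); split=> // q; apply: uniq.
move=> [[_ p1] pk] [[_ q1] qk]; apply/funext => x; apply/eqP.
rewrite -subr_eq0; apply/negPn/negP => dx.
have dk := inv_sub _ _ pk qk; set d := fun x => p x - q x in dk.
have nk := invariant_measure_norm kd dk.
have d0 : \sum_x d x = 0 by rewrite sumrB p1 q1 subrr.
have sd : 0 < \sum_x `|d x| by apply: (sum_norm_gt0 d x).
(* [|d| - d] and [|d| + d] are nonnegative, invariant and, as [d] sums to 0, of the same positive
   mass. Both are thus positive at [c], where one of them must vanish. *)
have /full : forall x, 0 <= `|d x| - d x by move=> y; rewrite subr_ge0 ler_norm.
rewrite sumrB d0 subr0 => /(_ (inv_sub _ _ nk dk) sd) dc.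
have dNk : invariant_measure (closed_loop K P) (fun x => - d x).
  by move=> y; rewrite {1}dk -sumrN; apply: eq_bigr => z _; rewrite mulNr.
have /full : forall x, 0 <= `|d x| - - d x.
  by move=> y; rewrite subr_ge0 -normrN ler_norm.
rewrite sumrB sumrN d0 oppr0 subr0 => /(_ (inv_sub _ _ nk dNk) sd).
by case: (ger0P (d c)) dc => _; rewrite ?subrr ?addNr ?opprK ?addNr ltxx.
Qed.

End UniqueInvariant.

(** * Trajectory weights and expected costs *)

Section Trajectories.
Variables (R : realType) (X U : finType) (K : X -> U -> X -> R).
Hypothesis K_kernel : forall x u, distr (K x u).

Lemma big_tuple_cons (A : finType) n (G : n.+1.-tuple A -> R) :
  \sum_w G w = \sum_a \sum_(w : n.-tuple A) G [tuple of a :: w].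
Proof.
rewrite (reindex (fun p : A * n.-tuple A => [tuple of p.1 :: p.2])) /=.
  by rewrite (pair_bigA _ (fun a (w : n.-tuple A) => G [tuple of a :: w])).
exists (fun w => (thead w, [tuple of behead w])) => [[a w] _|w _] /=.
  by congr pair; apply: val_inj.
by rewrite [RHS]tuple_eta; apply: val_inj.
Qed.

Lemma traj_sum_cons T (init : X -> R) Ps (Z : T.+1.-tuple (X * U) -> R) :
  \sum_(w : T.+1.-tuple (X * U)) traj_prob K init Ps w * Z w =
  \sum_x \sum_u init x * Ps 0%N x u *
    \sum_(w : T.-tuple (X * U))
      traj_prob K (K x u) (fun t => Ps t.+1) w * Z [tuple of (x, u) :: w].
Proof.
rewrite big_tuple_cons [RHS]pair_bigA; apply: eq_bigr => -[x u] _ /=.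
by rewrite mulr_sumr; apply: eq_bigr => w _; rewrite mulrA.
Qed.

Lemma traj_prob_total T (init : X -> R) (Ps : nat -> X -> U -> R) :
  distr init -> (forall t, (t < T)%N -> markov (Ps t)) ->
  \sum_(w : T.-tuple (X * U)) traj_prob K init Ps w = 1.
Proof.
elim: T init Ps => [|T IHT] init Ps init_distr mPs.
  rewrite (eq_bigr (fun=> 1)) => [|w _]; last by rewrite tuple0.
  by rewrite sumr_const card_tuple expn0.
under eq_bigr do rewrite -[traj_prob _ _ _ _]mulr1.
rewrite traj_sum_cons; transitivity (\sum_x init x); last exact: init_distr.2.
apply: eq_bigr => x _; rewrite -{2}[init x]mulr1.
rewrite -[X in _ = _ * X](mPs 0%N isT x).2 mulr_sumr.
apply: eq_bigr => u _; under [X in _ * X]eq_bigr do rewrite mulr1.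
by rewrite IHT ?mulr1 // => t tT; apply: mPs.
Qed.

(** Given the state at step [t], the action has law [Ps t] there, so it can be averaged out. The
    induction peels off first steps until step [t] comes first. *)
Lemma traj_prob_feedback T (init : X -> R) (Ps : nat -> X -> U -> R) (t : 'I_T)
    (g : X -> U -> R) :
  distr init -> (forall t, (t < T)%N -> markov (Ps t)) ->
  \sum_(w : T.-tuple (X * U))
     traj_prob K init Ps w * g (tnth w t).1 (tnth w t).2 =
  \sum_(w : T.-tuple (X * U))
     traj_prob K init Ps w * \sum_u Ps t (tnth w t).1 u * g (tnth w t).1 u.
Proof.
elim: T init Ps t => [|T IHT] init Ps t; first by case: t.
case: (unliftP ord0 t) => [s|] -> init_distr mPs.
  rewrite !traj_sum_cons.
  apply: eq_bigr => x _; apply: eq_bigr => u _; congr (_ * _).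
  under eq_bigr do rewrite tnthS.
  under [RHS]eq_bigr do rewrite tnthS.
  by rewrite IHT // => r rT; apply: mPs.
(* The future after the first pair integrates to 1. On the right the integrand is then free of the
   drawn action, and [Ps 0 x] sums to 1. *)
rewrite !traj_sum_cons.
have mPsS s : (s < T)%N -> markov (Ps s.+1) by move=> sT; apply: mPs.
apply: eq_bigr => x _; rewrite /=.
have tot (c : R) u : \sum_(w : T.-tuple (X * U))
    traj_prob K (K x u) (fun t => Ps t.+1) w * c = c.
  by rewrite -mulr_suml traj_prob_total ?mul1r.
under eq_bigr do rewrite tot.
under [RHS]eq_bigr do rewrite tot.
rewrite -mulr_suml -mulr_sumr (mPs 0%N isT x).2 mulr1 mulr_sumr.
by apply: eq_bigr => u _; rewrite mulrA.
Qed.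

Variables (gamma : strategy R X U) (T : nat) (f : T.-tuple (X -> U -> R)).
Hypothesis gamma_markov : forall t, (t < T)%N -> markov (feedback gamma f t).
Variable x : X.

Let point_mass_distr : distr (fun y => (y == x)%:R : R).
Proof.
split=> [y|]; first by rewrite ler0n.
by rewrite (bigD1 x) //= eqxx big1 ?addr0 // => y /negPf->.
Qed.

Lemma expectation_sumB (S : 'I_T -> X -> U -> R) (c : R) :
  expectation K gamma f x
    (fun w => (\sum_(t < T) S t (tnth w t).1 (tnth w t).2) - c) =
  \sum_(t < T) expectation K gamma f x
     (fun w => S t (tnth w t).1 (tnth w t).2) - c.
Proof.
rewrite /expectation; under eq_bigr do rewrite mulrBr.
rewrite sumrB -mulr_suml traj_prob_total // mul1r; congr (_ - _).
by rewrite exchange_big; apply: eq_bigr => w _; rewrite mulr_sumr.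
Qed.

Lemma expectation_state_action (t : 'I_T) (g : X -> U -> R) :
  expectation K gamma f x (fun w => g (tnth w t).1 (tnth w t).2) =
  pairing (state_distr K gamma f x t) (feedback gamma f t) g.
Proof.
rewrite /expectation traj_prob_feedback // /pairing /state_distr /expectation.
under [RHS]eq_bigr => y _.
  under eq_bigr do rewrite -mulrA.
  rewrite -mulr_sumr mulr_suml; over.
rewrite exchange_big; apply: eq_bigr => w _ /=.
rewrite (bigD1 (tnth w t).1) //= eqxx mulr1 [X in _ + X]big1 ?addr0 // => y yw.
by rewrite eq_sym (negPf yw) mulr0 mul0r.
Qed.

End Trajectories.

(** * Sensitivity of the average cost to the state distribution *)

Section SupNorm.
Variables (R : realType) (X U : finType).

Lemma le_sup_norm (g : X -> U -> R) x u : `|g x u| <= sup_norm g.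
Proof.
apply: le_trans (le_bigmax _ (fun y => \big[Num.max/0]_v `|g y v|) x).
exact: (le_bigmax _ (fun v => `|g x v|) u).
Qed.

Lemma pairing_l1 (p q : X -> R) (P g : X -> U -> R) (c : R) :
  markov P -> sup_norm g <= c ->
  pairing p P g - pairing q P g <= c * l1_norm (fun y => p y - q y).
Proof.
move=> mP gc; rewrite /pairing -sumrB mulr_sumr; apply: ler_sum => y _.
have -> : \sum_u p y * P y u * g y u - \sum_u q y * P y u * g y u =
    \sum_u P y u * ((p y - q y) * g y u).
  rewrite -sumrB; apply: eq_bigr => u _.
  by rewrite -mulrBl -mulrBl mulrAC mulrC.
(* Writing the right side as an average under [P y] allows a comparison action by action. *)
rewrite -[leRHS]mul1r -(mP y).2 mulr_suml; apply: ler_sum => u _.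
apply: ler_wpM2l; first exact: (mP y).1.
apply: le_trans (ler_norm _) _; rewrite normrM mulrC ler_wpM2r //.
exact: le_trans (le_sup_norm g y u) gc.
Qed.

End SupNorm.

(** * Comparing two stationary policies *)

Section PerformanceDifference.
Variables (R : realType) (X U : finType) (K : X -> U -> X -> R).

(* Integrating the inequality against [p \otimes P'], the forward term becomes
   the [p]-average of [\sum_u P y u * Q y u] by invariance of [p]. *)
Lemma reverse_poisson_invariant (P P' g Q : X -> U -> R) (p : X -> R) :
  markov P' -> invariant_distr K P' p -> reverse_poisson K P g Q ->
  pairing (inv_distr K P) P g - pairing p P' g <=
  \sum_y p y * (\sum_u P y u * Q y u - \sum_u P' y u * Q y u).
Proof.
move=> mP' [[p0 p1] pinv] poisson.
set c := pairing (inv_distr K P) P g; pose q y := \sum_u P y u * Q y u.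
have -> : \sum_y p y * (q y - \sum_u P' y u * Q y u) =
    \sum_x \sum_u p x * P' x u * (\sum_y K x u y * q y - Q x u).
  under [LHS]eq_bigr do rewrite mulrBr.
  under [RHS]eq_bigr => x _ do
    (under eq_bigr do rewrite mulrBr; rewrite sumrB).
  rewrite !sumrB; congr (_ - _); last first.
    apply: eq_bigr => x _; rewrite mulr_sumr.
    by apply: eq_bigr => u _; rewrite mulrA.
  under [LHS]eq_bigr do rewrite pinv mulr_suml.
  rewrite exchange_big; apply: eq_bigr => x _ /=.
  under [RHS]eq_bigr do rewrite mulr_sumr.
  rewrite [RHS]exchange_big; apply: eq_bigr => y _ /=.
  rewrite /closed_loop -mulrA mulr_suml mulr_sumr; apply: eq_bigr => u _.
  by rewrite [K x u y * P' x u]mulrC !mulrA.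
(* The weights [p x * P' x u] sum to 1, so [c] goes under the sum and the inequality can be applied
   pointwise. *)
have -> : c - pairing p P' g =
    \sum_x \sum_u p x * P' x u * (- g x u + c).
  under [RHS]eq_bigr => x _.
    under eq_bigr do rewrite mulrDr mulrN.
    rewrite big_split /= sumrN -mulr_suml -mulr_sumr (mP' x).2 mulr1; over.
  by rewrite big_split /= sumrN -mulr_suml p1 mul1r addrC.
apply: ler_sum => x _; apply: ler_sum => u _; apply: ler_wpM2l.
  by rewrite mulr_ge0 // (mP' x).1.
exact: poisson.
Qed.

End PerformanceDifference.

(** * Regret of the relaxation strategy at a single state *)

Section Relaxation.
Variables (R : realType) (X U : finType).

(** The bound is uniform in [nu]; it supplies the boundedness that real-valued [inf] and [sup]
    require. *)
Lemma distr_sum_norm (nu s : U -> R) :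
  distr nu -> `|\sum_u nu u * s u| <= \sum_u `|s u|.
Proof.
move=> [nu0 nu1]; apply: le_trans (ler_norm_sum _ _ _) _.
apply: ler_sum => u _; rewrite normrM (ger0_norm (nu0 u)) ler_piMl //.
by rewrite -nu1 (bigD1 u) //= lerDl sumr_ge0.
Qed.

(** Entry [s] depends only on the first [s.+1] functions, so the histories met along the game are
    prefixes of one sequence. *)
Lemma Qhistory_take Q (gamma : strategy R X U) (fs : seq (X -> U -> R)) y t :
  (t <= size fs)%N ->
  Qhistory Q gamma (take t fs) y =
  mkseq (fun s => Q (feedback gamma fs s) (nth (fun _ _ => 0) fs s) y) t.
Proof.
move=> tfs; rewrite /Qhistory size_takel //; apply/eq_in_map => s.
rewrite mem_iota add0n => /= st.
by rewrite /feedback take_takel ?nth_take // ltnW.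
Qed.

Variables (F : set (X -> U -> R)) (T : nat).
Variables (Q : (X -> U -> R) -> (X -> U -> R) -> X -> U -> R).
Variables (W : X -> seq (U -> R) -> R) (gamma : strategy R X U).
Hypothesis W_admissible : forall y, admissible T (Qclass F Q y) (W y).
Hypothesis gamma_relax : relaxation_strategy T F Q W gamma.
Variable f : T.-tuple (X -> U -> R).
Hypothesis f_in_F : forall t, F (tnth f t).

Let nth_F s : (s < T)%N -> F (nth (fun _ _ => 0) f s).
Proof. by move=> sT; rewrite -(tnth_nth _ f (Ordinal sT)). Qed.

Let prefix_F t (tT : (t <= T)%N) :
  exists2 fs : t.-tuple (X -> U -> R),
    take t f = fs & forall i, F (tnth fs i).
Proof.
have sz : size (take t f) == t by rewrite size_takel // size_tuple.
exists (Tuple sz) => // i; rewrite (tnth_nth (fun _ _ => 0)) /= nth_take //.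
by apply: nth_F; apply: leq_trans tT.
Qed.

Lemma relaxation_feedback_markov t : (t < T)%N -> markov (feedback gamma f t).
Proof.
move=> tT y; have [fs fsE fsF] := prefix_F (ltnW tT).
by rewrite /feedback fsE; have [] := gamma_relax tT fsF y.
Qed.

(** Indices start at 0: this is the loss $h_{y,s+1}$. *)
Let h y s : U -> R := Q (feedback gamma f s) (nth (fun _ _ => 0) f s) y.

Let hF y s : (s < T)%N -> Qclass F Q y (h y s).
Proof.
move=> sT; exists (feedback gamma f s), (nth (fun _ _ => 0) f s).
by split=> //; [exact: relaxation_feedback_markov | exact: nth_F].
Qed.

Let historyE y t : (t <= T)%N ->
  Qhistory Q gamma (take t f) y = mkseq (h y) t.
Proof. by move=> tT; rewrite Qhistory_take ?size_tuple. Qed.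

Let historyF y t : (t <= T)%N -> exists2 hs : t.-tuple (U -> R),
  mkseq (h y) t = hs & forall i, Qclass F Q y (tnth hs i).
Proof.
move=> tT; have sz : size (mkseq (h y) t) == t by rewrite size_mkseq.
exists (Tuple sz) => // i; rewrite (tnth_nth (fun _ => 0)) nth_mkseq //.
apply: hF; exact: leq_trans tT.
Qed.

(** The law played attains the infimum in the admissibility inequality, and its supremum over losses
    dominates the value at the actual loss [h y t]. *)
Let relaxation_step y t : (t < T)%N ->
  \sum_u feedback gamma f t y u * h y t u + W y (mkseq (h y) t.+1)
    <= W y (mkseq (h y) t).
Proof.
move=> tT; have [fs fsE fsF] := prefix_F (ltnW tT).
have [hs hsE hsF] := historyF y (ltnW tT).
have [_ /(_ t tT hs hsF)] := W_admissible y.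
have [gd gmin] := gamma_relax tT fsF y.
rewrite mkseqS hsE -lee_fin; apply: le_trans.
apply: (@le_trans _ _
  (relax_value (Qclass F Q y) (W y) hs (feedback gamma f t y))).
  by apply: ereal_sup_ubound; exists (h y t) => //; apply: hF.
rewrite /feedback fsE -hsE -historyE 1?ltnW // fsE.
by apply: le_ereal_inf_tmp => _ [nu nud <-]; apply: gmin.
Qed.

Lemma relaxation_regret y (nu : U -> R) : distr nu ->
  \sum_(t < T)
    (\sum_u feedback gamma f t y u * Q (feedback gamma f t) (tnth f t) y u
     - \sum_u nu u * Q (feedback gamma f t) (tnth f t) y u) <= W y [::].
Proof.
move=> nud.
have hE (t : 'I_T) : Q (feedback gamma f t) (tnth f t) y = h y t.
  by rewrite /h (tnth_nth (fun _ _ => 0)).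
have tele t : (t <= T)%N ->
    \sum_(s < t) \sum_u feedback gamma f s y u * h y s u + W y (mkseq (h y) t)
    <= W y [::].
  elim: t => [|t IHt] tT; first by rewrite big_ord0 add0r.
  rewrite big_ord_recr -addrA; apply: le_trans (IHt (ltnW tT)).
  by rewrite lerD2l; apply: relaxation_step.
apply: le_trans (tele T (leqnn T)); rewrite sumrB.
under eq_bigr do rewrite hE.
rewrite lerD2l; have [hs hsE hsF] := historyF y (leqnn T).
(* The terminal condition trades the last relaxation value for the cumulative loss of the best fixed
   law, which [nu] cannot beat. *)
have [/(_ hs hsF) + _] := W_admissible y; rewrite -hsE; apply: le_trans.
rewrite lerN2; set s := fun u => \sum_(t < T) tnth hs t u.
apply: (@le_trans _ _ (\sum_u nu u * s u)).
  apply: ge_inf; last by exists nu.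
  exists (- \sum_u `|s u|) => _ [nu' nud' <-].
  by apply: lerNnormlW; apply: distr_sum_norm.
rewrite exchange_big; under [leLHS]eq_bigr do rewrite mulr_sumr.
rewrite le_eqVlt; apply/predU1P; left.
apply: eq_bigr => u _; apply: eq_bigr => t _.
by rewrite hE (tnth_nth (fun _ => 0)) -hsE nth_mkseq.
Qed.

End Relaxation.

Theorem theorem1 (R : realType) (X U : finType)
  (X_nonempty : (0 < #|X|)%N) (U_nonempty : (0 < #|U|)%N)
  (K : X -> U -> X -> R) (K_kernel : forall x u, distr (K x u))
  (F : set (X -> U -> R)) (F_nonempty : F !=set0)
  (F_bounded : has_ubound [set sup_norm f | f in F])
  (T : nat) (T_ge1 : (1 <= T)%N)
  (K_unichain : unichain K)
  (Q : (X -> U -> R) -> (X -> U -> R) -> X -> U -> R)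
  (Q_poisson : forall P f, markov P -> F f -> reverse_poisson K P f (Q P f))
  (Q_bounded : has_ubound
     [set sup_norm (Q P f) | P in @markov R X U & f in F])
  (W : X -> seq (U -> R) -> R)
  (W_admissible : forall y, admissible T (Qclass F Q y) (W y))
  (gamma : strategy R X U)
  (gamma_relax : relaxation_strategy T F Q W gamma)
  (x : X) (f : T.-tuple (X -> U -> R)) (f_in_F : forall t, F (tnth f t)) :
  expectation K gamma f x
    (fun w => (\sum_(t < T) tnth f t (tnth w t).1 (tnth w t).2)
              - comparator K f)
  <= sup [set \sum_y inv_distr K P y * W y [::] | P in @markov R X U]
     + class_bound F *
       \sum_(t < T) l1_norm (fun y => state_distr K gamma f x t y
                                      - inv_distr K (feedback gamma f t) y).

Proof.
have mP t : (t < T)%N -> markov (feedback gamma f t).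
  by move=> tT; apply: (relaxation_feedback_markov gamma_relax f_in_F).
set Pt := fun t : 'I_T => feedback gamma f t.
rewrite (expectation_sumB K_kernel mP x (tnth f)).
under eq_bigr => t _ do rewrite (expectation_state_action K_kernel mP).
set D := class_bound F * _.
have tracking :
    \sum_(t < T) pairing (state_distr K gamma f x t) (Pt t) (tnth f t) <=
    \sum_(t < T) pairing (inv_distr K (Pt t)) (Pt t) (tnth f t) + D.
  rewrite /D mulr_sumr -big_split; apply: ler_sum => t _ /=.
  rewrite -lerBlDl; apply: pairing_l1; first exact: mP.
  by apply: ub_le_sup F_bounded _ _; exists (tnth f t).
set S := sup _; apply: le_trans (lerB tracking (lexx _)) _.
rewrite addrAC lerD2r lerBlDr -lerBlDl.
(* The stationary cost minus [S] has to be a lower bound of the set defining the comparator, so each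
   competitor [P] is handled separately. Nonemptiness is witnessed by the law that always plays
   [u0]. *)
apply: lb_le_inf => [|_ [P [mPP [p [ip _]]] <-]].
  have [u0 _] := card_gt0P U_nonempty.
  pose P (_ : X) u : R := (u == u0)%:R.
  have mPP : markov P.
    move=> y; split=> [u|]; first by rewrite ler0n.
    by rewrite (bigD1 u0) //= /P eqxx big1 ?addr0 // => u /negPf->.
  exists (\sum_(t < T) pairing (inv_distr K P) P (tnth f t)), P => //.
  by split=> //; apply: unichain_unique_invariant.
(* Existence ensures that [xget] returns an invariant distribution and not its default 0. *)
have iP : invariant_distr K P (inv_distr K P) by apply: xgetPex; exists p.
rewrite lerBlDl -lerBlDr -sumrB.
apply: (@le_trans _ _ (\sum_y inv_distr K P y * W y [::])).
  apply: (@le_trans _ _ (\sum_(t < T) \sum_y inv_distr K P y *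
      (\sum_u Pt t y u * Q (Pt t) (tnth f t) y u
       - \sum_u P y u * Q (Pt t) (tnth f t) y u))).
    apply: ler_sum => t _; apply: (reverse_poisson_invariant mPP iP).
    by apply: Q_poisson; [exact: mP | exact: f_in_F].
  rewrite exchange_big; apply: ler_sum => y _ /=; rewrite -mulr_sumr.
  apply: ler_wpM2l; first by case: iP => -[].
  exact (relaxation_regret W_admissible gamma_relax f_in_F y (mPP y)).
apply: ub_le_sup; last by exists P.
(* [sup] dominates its members only for a set bounded above; averages of [W y [::]] are at most the
   sum of absolute values. *)
exists (\sum_y `|W y [::]|) => _ [P' mP' <-].
have [pd _] : invariant_distr K P' (inv_distr K P').
  have [p' [ip' _]] :=
    unichain_unique_invariant K_kernel X_nonempty K_unichain mP'.
  by apply: xgetPex; exists p'.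
exact: le_trans (ler_norm _) (distr_sum_norm _ pd).
Qed.
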